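(* Let $k,n\geq 1$ be integers and let $T\in\mathcal{F}(C_{k;n})$ be a sequence of length $$|T|\geq \begin{cases}\left\lfloor\frac{(\lceil k/n\rceil+1)\,n}{2}\right\rfloor, & \text{if } k>n;\\[4pt] \left\lfloor\frac{n}{2}\right\rfloor+1, & \text{otherwise.}\end{cases}$$ Then $T$ is idempotent-sum free if and only if one of the following two conditions holds: (i) $k>n$, the sequence $\mathop{\bullet}_{a\mid T}\mathrm{ind}(a)\in\mathcal{F}(\mathbb{Z})$ is $1$-smooth, and $\sum_{a\mid T}\mathrm{ind}(a)\leq \lceil k/n\rceil n-1$; (ii) $k\leq n$, and the sequence $\mathop{\bullet}_{a\mid T}(\mathrm{ind}(a)+n\mathbb{Z})\in\mathcal{F}(\mathbb{Z}/n\mathbb{Z})$ is $g$-smooth for some $g\in\mathbb{Z}/n\mathbb{Z}$ with $\mathrm{ord}(g)=n$.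
   Context: Cyclic semigroups. $C_{k;n}=\langle s\rangle$ denotes the finite cyclic semigroup (written additively) with generator $s$, index $k$ and period $n$: $k$ is the least positive integer such that $ks=ts$ for some positive integer $t\neq k$, and $n$ is the least positive integer with $(k+n)s=ks$. So $C_{k;n}=\{s,2s,\ldots,(k+n-1)s\}$ has $k+n-1$ elements; for $k=1$ it is the cyclic group of order $n$. The generator $s$ is fixed, and for $a\in C_{k;n}$, $\mathrm{ind}(a)$ is the least positive integer $t$ with $ts=a$. An element $e$ is idempotent if $e+e=e$. Sequences. For a set $\mathcal{S}$, $\mathcal{F}(\mathcal{S})$ is the set of finite unordered sequences (multisets) of terms from $\mathcal{S}$, repetition allowed; $|T|$ is the number of terms of $T$ counted with multiplicity. For a commutative semigroup $\mathcal{S}$ and $T\in\mathcal{F}(\mathcal{S})$, $\Sigma(T)$ is the set of all sums of nonempty subsequences of $T$. Sums $\sum_{a\mid T}$ and products $\mathop{\bullet}_{a\mid T}$ are over the terms of $T$ with multiplicity; $\mathop{\bullet}_{a\mid T} f(a)$ denotes the sequence obtained from $T$ by applying $f$ to each term. $T$ is idempotent-sum free if no nonempty subsequence of $T$ has an idempotent as its sum. Smooth sequences. Let $G$ be an abelian group and $g\in G$. A nonempty sequence $T\in\mathcal{F}(G)$ is $g$-smooth if it can be written $T=(n_1g)\cdot\ldots\cdot(n_\ell g)$ with integers $1=n_1\leq\cdots\leq n_\ell$, $N=n_1+\cdots+n_\ell<\mathrm{ord}(g)$ and $\Sigma(T)=\{g,2g,\ldots,Ng\}$. In particular (taking $G=\mathbb{Z}$,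 $g=1$, of infinite order), a nonempty sequence $T$ of positive integers is $1$-smooth if and only if $\Sigma(T)=[1,\sum_{a\mid T}a]$, where $[a,b]$ denotes an interval of integers. *)

(* Defs.v *)
From HB Require Import structures.
From mathcomp Require Import all_boot all_order all_algebra.

Set Implicit Arguments.
Unset Strict Implicit.
Unset Printing Implicit Defensive.

Import GRing.Theory.
Local Open Scope ring_scope.

Definition least (P : nat -> Prop) (m : nat) : Prop :=
  P m /\ forall j : nat, P j -> (m <= j)%N.

(* The multiple t s in a semigroup, which need not have a zero; it is only
   meaningful for t > 0 (t = 0 gives s). *)
Definition smul (S : addSemigroupType) (s : S) (t : nat) : S :=
  iter t.-1 (+%R s) s.

Record cyclic_semigroup (S : addSemigroupType) (s : S) (k n : nat) : Prop := {
  cyclic_gen : forall a : S, exists t : nat, (0 < t)%N && (smul s t == a);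
  cyclic_index :
    least (fun i => (0 < i)%N /\
             exists t : nat, [/\ (0 < t)%N, t <> i & smul s i = smul s t]) k;
  cyclic_period :
    least (fun p => (0 < p)%N /\ smul s (k + p) = smul s k) n
}.

Definition ind (S : addSemigroupType) (s : S) (k n : nat)
    (C : cyclic_semigroup s k n) (a : S) : nat :=
  ex_minn (cyclic_gen C a).

(* An unordered sequence is represented by a list, up to perm_eq: each notion
   below is invariant under permutation of the list.  A nonempty list is
   written x :: U so that its sum needs no zero. *)
Definition subsums (S : addSemigroupType) (T : seq S) (a : S) : Prop :=
  exists x U, subseq (x :: U) T /\ a = foldl +%R x U.

Definition idempotent_sum_free (S : addSemigroupType) (T : seq S) : Prop :=
  forall e : S, subsums T e -> e + e <> e.

(* ord(g) = m; there is no such m when g has infinite order. *)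
Definition add_order (G : zmodType) (g : G) (m : nat) : Prop :=
  least (fun i => (0 < i)%N /\ g *+ i = 0) m.

(* N < ord(g), where ord(g) may be infinite. *)
Definition lt_add_order (G : zmodType) (N : nat) (g : G) : Prop :=
  forall m : nat, add_order g m -> (N < m)%N.

(* The coefficients satisfy 1 = n_1 <= ... <= n_l, so they are naturals. *)
Definition smooth (G : zmodType) (g : G) (T : seq G) : Prop :=
  exists ns : seq nat,
    [/\ perm_eq T [seq g *+ m | m <- ns],
        ohead ns = Some 1%N /\ sorted leq ns,
        lt_add_order (sumn ns) g
      & forall a : G,
          subsums T a <-> exists2 j : nat, (1 <= j <= sumn ns)%N & a = g *+ j].

(* The ceiling of k / n, for n > 0. *)
Definition ceil_div (k n : nat) : nat := ((k + n - 1) %/ n)%N.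

(* Z/nZ for n > 0.  Unlike 'Z_n, this is the trivial group when n = 1. *)
Definition Zmod (n : nat) : zmodType := 'I_n.-1.+1.

Definition to_Zmod (n : nat) (m : nat) : Zmod n := inZp m.

(* Main.v *)
(* The idempotent of C_{k;n} is the multiple t s with n | t and t >= k, so T is
   idempotent-sum free iff every nonempty subsum of the indices that is divisible
   by n is < ceil(k/n) n.

   For k <= n this says that the residues mod n are zero-sum free, and we need
   the Savchev-Chen theorem.  In the form: a zero-sum free A with fewer than 2|A|
   subset sums (counting 0) is smooth, it has a short induction: if removing some
   x loses at least two sums, A \ x is smooth and absorbs x; otherwise all terms
   are equal.

   For k > n put K = ceil(k/n).  The residues mod Kn are zero-sum free, hence
   congruent to c_i g with sum c_i < Kn.  At least n of the c_i are 1, so each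
   index can be completed to a sum divisible by n; this makes it < Kn, i.e. equal
   to c_i g reduced mod Kn.  Comparing sums of those c_i with c_i g < Kn to Kn
   forces g = 1, so the sum of the indices is sum c_i < Kn; and positive integers
   with sum less than twice their number are 1-smooth. *)
Require Import Defs.
From mathcomp Require Import all_boot all_order all_algebra zify.

Local Open Scope ring_scope.
Import GRing.Theory.

(** * Subset sums of positive integers with a small total *)

Lemma leq_card_sum {I : finType} (c : I -> nat) (A : {set I}) :
  (forall i, i \in A -> (0 < c i)%N) -> (#|A| <= \sum_(i in A) c i)%N.
Proof. by move=> c0; rewrite -sum1_card leq_sum. Qed.

(** Induction on [A], removing some [x] with [c x > 1] if there is one, so that the rest satisfies
    the same bound. The rest sums to at least [#|A| - 1], so the bound leaves [c x] at most one more
    than that sum, and adding [x] reaches every [j] beyond it. *)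
Lemma subset_sum_interval {I : finType} (c : I -> nat) (A : {set I}) :
  (forall i, i \in A -> (0 < c i)%N) ->
  (\sum_(i in A) c i <= #|A|.*2.-1)%N ->
  forall j, (j <= \sum_(i in A) c i)%N ->
  exists2 B : {set I}, B \subset A & (\sum_(i in B) c i)%N = j.
Proof.
have [m] := ubnP #|A|; elim: m A => // m IH A Am c0 cA j jA.
have [A0 | [y yA]] := set_0Vmem A.
  by exists set0; rewrite ?sub0set // big_set0; move: jA; rewrite A0 big_set0; lia.
have [x xA c_rest] : exists2 x, x \in A &
    (\sum_(i in A :\ x) c i <= #|A :\ x|.*2.-1)%N.
  have [/existsP[x /andP[xA cx]] | /existsPn c1] :=
      boolP [exists x, (x \in A) && (1 < c x)%N].
    exists x => //; move: cA c0 (leq_card_sum c (A :\ x)).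
    rewrite (big_setD1 _ xA) (cardsD1 x A) xA /= => cA c0 cge.
    have := cge (fun i iA => c0 i (subsetP (subsetDl _ _) i iA)); lia.
  exists y => //; rewrite (eq_bigr (fun=> 1%N)) ?sum1_card; first by lia.
  move=> i /setD1P[_ iA]; move: (c1 i) (c0 i iA); rewrite iA /=; lia.
have c0' i : i \in A :\ x -> (0 < c i)%N by case/setD1P=> _ /c0.
have := leq_card_sum _ _ c0'.
move: cA jA Am; rewrite (big_setD1 _ xA) (cardsD1 x A) xA /= => cA jA Am cge.
have Am' : (#|A :\ x| < m)%N by lia.
have [jle | jgt] := leqP j (\sum_(i in A :\ x) c i)%N.
  have [B BA Bj] := IH _ Am' c0' c_rest j jle.
  by exists B => //; apply: subset_trans BA (subsetDl _ _).
have [|B BA Bj] := IH _ Am' c0' c_rest (j - c x)%N; first by lia.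
exists (x |: B).
  by rewrite subUset sub1set xA (subset_trans BA) ?subsetDl.
rewrite big_setU1 ?Bj /=; first by lia.
by apply/negP => /(subsetP BA); rewrite !inE eqxx.
Qed.

Lemma exists_subset_card {I : finType} (A : {set I}) (j : nat) :
  (j <= #|A|)%N -> exists2 B : {set I}, B \subset A & #|B| = j.
Proof.
rewrite -sum1_card => jA.
have [//||//|B BA Bj] := subset_sum_interval (fun=> 1%N) A _ _ j.
  by rewrite /= sum1_card; lia.
by exists B; rewrite // -sum1_card.
Qed.

(** * Zero-sum free families in a finite abelian group and the Savchev-Chen theorem *)

Definition sumset {I : finType} {G : finZmodType} (f : I -> G) (A : {set I}) :
  {set G} := [set \sum_(i in B) f i | B : {set I} in powerset A].

Definition zero_free {I : finType} {G : zmodType} (f : I -> G) (A : {set I}) :=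
  forall B : {set I}, B \subset A -> B != set0 -> \sum_(i in B) f i != 0.

Lemma sumsetP {I : finType} {G : finZmodType} (f : I -> G) (A : {set I}) a :
  reflect (exists2 B : {set I}, B \subset A & a = \sum_(i in B) f i)
    (a \in sumset f A).
Proof.
apply: (iffP imsetP) => [[B BA ->] | [B BA ->]];
  by exists B; rewrite ?inE // -powersetE.
Qed.

Lemma mem0_sumset {I : finType} {G : finZmodType} (f : I -> G) (A : {set I}) :
  0 \in sumset f A.
Proof. by apply/sumsetP; exists set0; rewrite ?sub0set ?big_set0. Qed.

Lemma sumsetD1 {I : finType} {G : finZmodType} (f : I -> G) (A : {set I}) x :
  x \in A ->
  sumset f A = sumset f (A :\ x) :|: [set f x + a | a in sumset f (A :\ x)].
Proof.
move=> xA; apply/setP => a; rewrite inE.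
apply/sumsetP/orP => [[B BA ->] | [/sumsetP[B BA ->] | /imsetP[_ /sumsetP[B BA ->] ->]]].
- have [xB | xB] := boolP (x \in B); last first.
    left; apply/sumsetP; exists B => //; apply/subsetP => i iB.
    by rewrite !inE (subsetP BA) // andbT; apply: contraNneq xB => <-.
  right; apply/imsetP; exists (\sum_(i in B :\ x) f i).
    by apply/sumsetP; exists (B :\ x); rewrite ?setSD.
  by rewrite (big_setD1 _ xB).
- by exists B => //; apply: subset_trans BA (subsetDl _ _).
- exists (x |: B); first by rewrite subUset sub1set xA (subset_trans BA) ?subsetDl.
  rewrite big_setU1 //=; apply/negP => /(subsetP BA); by rewrite !inE eqxx.
Qed.

Lemma zero_freeS {I : finType} {G : zmodType} (f : I -> G) (A B : {set I}) :
  B \subset A -> zero_free f A -> zero_free f B.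
Proof. by move=> BA fA D DB; apply: fA; apply: subset_trans DB BA. Qed.

Lemma zero_free_sumsetD1 {I : finType} {G : finZmodType} (f : I -> G)
    (A : {set I}) x : zero_free f A -> x \in A ->
  forall a, a \in sumset f (A :\ x) -> f x + a != 0.
Proof.
move=> fA xA a /sumsetP[B BA ->].
have xB : x \notin B by apply/negP => /(subsetP BA); rewrite !inE eqxx.
rewrite -[X in X != _](big_setU1 _ xB); apply: fA.
  by rewrite subUset sub1set xA (subset_trans BA) ?subsetDl.
by apply/set0Pn; exists x; rewrite !inE eqxx.
Qed.

(** If [B] missed [x] and had the same sum as [A], then [A :\: B], which contains [x], would have
    sum 0. *)
Lemma total_notin_sumsetD1 {I : finType} {G : finZmodType} (f : I -> G)
    (A : {set I}) x : zero_free f A -> x \in A ->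
  \sum_(i in A) f i \notin sumset f (A :\ x).
Proof.
move=> fA xA; apply/negP => /sumsetP[B BA].
have BA' : B \subset A by apply: subset_trans BA (subsetDl _ _).
rewrite (big_setID B) /= (setIidPr BA') => /eqP.
rewrite -subr_eq0 addrAC subrr add0r; apply/negP; apply: fA; first exact: subsetDl.
apply/set0Pn; exists x; rewrite inE xA andbT.
by apply/negP => /(subsetP BA); rewrite !inE eqxx.
Qed.

(* If removing any x from A loses a single subset sum, it is the total t, and
   W := sumset A \ t satisfies W + f x = sumset A \ 0 for every x.  Hence W is
   stable under all f x - f y; as 0 is in W but not in W + f x, these vanish. *)
Lemma sumset_unit_gain {I : finType} {G : finZmodType} (f : I -> G) (A : {set I}) :
  zero_free f A ->
  (forall x, x \in A -> (#|sumset f A| <= #|sumset f (A :\ x)|.+1)%N) ->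
  {in A &, forall x y, f x = f y}.
Proof.
move=> fA gain.
pose W := sumset f A :\ \sum_(i in A) f i.
have tA : \sum_(i in A) f i \in sumset f A by apply/sumsetP; exists A.
have WE x : x \in A -> sumset f (A :\ x) = W.
  move=> xA; apply/eqP; rewrite eqEcard; apply/andP; split.
    apply/subsetP => a aW; rewrite !inE (sumsetD1 _ _ _ xA) inE aW /= andbT.
    by apply: contraTneq aW => ->; apply: total_notin_sumsetD1.
  by have := gain x xA; rewrite (cardsD1 (\sum_(i in A) f i)) tA.
have shift x : x \in A -> [set f x + a | a in W] = sumset f A :\ 0.
  move=> xA; apply/eqP; rewrite eqEcard; apply/andP; split.
    apply/subsetP => _ /imsetP[a aW ->]; rewrite -(WE x xA) in aW.
    rewrite !inE (zero_free_sumsetD1 _ _ _ fA xA _ aW) (sumsetD1 _ _ _ xA) inE /=.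
    by rewrite imset_f ?orbT.
  rewrite card_imset; last exact: addrI.
  have := cardsD1 (\sum_(i in A) f i) (sumset f A).
  by rewrite tA (cardsD1 0 (sumset f A)) mem0_sumset !add1n => -[->].
move=> x y xA yA; apply/eqP; rewrite -subr_eq0; apply/negPn/negP => xy.
have WA a : a \in W -> f y + a != 0.
  by rewrite -(WE y yA); apply: zero_free_sumsetD1.
(* If [f x != f y], then [f x - f y] lies in [W], hence in [f x + W]; this puts [- f y] in [W],
   against [WA]. *)
have dW : f x - f y \in W.
  have : f x + 0 \in sumset f A :\ 0.
    by rewrite -(shift x xA) imset_f // -(WE x xA) mem0_sumset.
  by rewrite addr0 -(shift y yA) => /imsetP[a aW ->]; rewrite addrC addKr.
have : f x - f y \in sumset f A :\ 0.
  by move: dW; rewrite !inE xy => /andP[].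
rewrite -(shift x xA) => /imsetP[a aW /addrI ea].
by have := WA _ aW; rewrite -ea subrr eqxx.
Qed.

(** The induction carries the first, second and fourth conjuncts. By the second, the multiples in
    the fourth are distinct, so [sumset f A] has one more element than the sum of the [c i], and the
    third conjunct is the cardinality hypothesis restated. *)
Lemma savchev_chen {I : finType} {G : finZmodType} (f : I -> G) (A : {set I}) :
  zero_free f A -> (#|sumset f A| < #|A|.*2)%N ->
  exists (g : G) (c : I -> nat),
    [/\ forall i, i \in A -> (0 < c i)%N /\ f i = g *+ c i,
        forall j, (0 < j <= \sum_(i in A) c i)%N -> g *+ j != 0,
        (\sum_(i in A) c i < #|A|.*2.-1)%N
      & forall a, a \in sumset f A <->
                    exists2 j, (j <= \sum_(i in A) c i)%N & a = g *+ j].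
Proof.
have [m] := ubnP #|A|; elim: m A => // m IH A Am fA cA.
have [y yA] : exists y, y \in A.
  by apply/set0Pn/negP => /eqP A0; move: cA; rewrite A0 cards0.
have inj_mul (g : G) N : (forall j, (0 < j <= N)%N -> g *+ j != 0) ->
    {in [pred j | (j <= N)%N] &, injective (fun j => g *+ j)}.
  move=> gN; suff lt_neq i j : (i < j <= N)%N -> g *+ i != g *+ j.
    move=> i j; rewrite !inE => iN jN e; case: (ltngtP i j) => // ij.
      by have := lt_neq i j; rewrite e eqxx ij jN => /(_ isT).
    by have := lt_neq j i; rewrite e eqxx ij iN => /(_ isT).
  case/andP=> ij jN; rewrite eq_sym -subr_eq0 -mulrnBr ?(ltnW ij) //.
  by apply: gN; rewrite subn_gt0 ij (leq_trans (leq_subr _ _)).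
have card_sum (g : G) N B : (forall j, (0 < j <= N)%N -> g *+ j != 0) ->
    (forall a, a \in sumset f B <-> exists2 j, (j <= N)%N & a = g *+ j) ->
    #|sumset f B| = N.+1.
  move=> gN sN.
  have -> : sumset f B = [set g *+ val j | j : 'I_N.+1].
    apply/setP => a; apply/idP/imsetP => [/sN[j jN ->] | [j _ ->]].
      by exists (Ordinal (jN : (j < N.+1)%N)).
    by apply/sN; exists (val j); rewrite // -ltnS ltn_ord.
  rewrite card_imset ?card_ord // => i j ij; apply: val_inj.
  by apply: (inj_mul g N gN) ij; rewrite inE -ltnS ltn_ord.
suff [g [c [fc gN sN]]] : exists (g : G) (c : I -> nat),
    [/\ forall i, i \in A -> (0 < c i)%N /\ f i = g *+ c i,
        forall j, (0 < j <= \sum_(i in A) c i)%N -> g *+ j != 0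
      & forall a, a \in sumset f A <->
                    exists2 j, (j <= \sum_(i in A) c i)%N & a = g *+ j].
  exists g, c; split=> //; rewrite -ltnS -(card_sum g _ _ gN sN) prednK //.
  by apply: leq_ltn_trans cA.
have [/existsP[x /andP[xA gain]] | /existsPn gain] := boolP
    [exists x, (x \in A) && (#|sumset f (A :\ x)|.+1 < #|sumset f A|)%N].
  have cAx := cardsD1 x A; rewrite xA in cAx.
  have fAx : zero_free f (A :\ x) by apply: zero_freeS (subsetDl _ _) fA.
  (* The hypothesis survives: [#|sumset f (A :\ x)| + 2 <= #|sumset f A| <= 2 #|A| - 1]. *)
  have [||g [c [fc gN cN sN]]] := IH (A :\ x) _ fAx; [lia | lia |].
  set N := (\sum_(i in A :\ x) c i)%N in gN cN sN.
  have sA := sumsetD1 f A x xA.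
  have Nge : (#|A :\ x| <= N)%N by apply: leq_card_sum => i /fc[].
  (* Otherwise [0, N] g and f x + [0, N] g are disjoint subsets of sumset f A. *)
  have [i iN fxi] : exists2 i, (0 < i <= N)%N & f x = g *+ i.
    have meets : ~~ [disjoint sumset f (A :\ x)
                     & [set f x + a | a in sumset f (A :\ x)]].
      apply/negP => dis; move: cA; rewrite sA cardsU disjoint_setI0 // cards0 subn0.
      rewrite (card_imset _ (addrI (f x))).
      rewrite (card_sum _ _ _ gN sN); lia.
    have [a /andP[/sN[j jN ->] /imsetP[_ /sN[l lN ->] e]]] := pred0Pn meets.
    (* Here [g j = f x + g l]; if [j <= l], then [x] together with a subset of sum [g (l - j)] has
       sum 0. *)
    have [jl | lj] := leqP j l.
      have /eqP[] := zero_free_sumsetD1 _ _ _ fA xA (g *+ (l - j)) (ltac:(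
        apply/sN; exists (l - j)%N => //; lia)).
      by rewrite mulrnBr // addrA -e subrr.
    exists (j - l)%N; first lia.
    by rewrite mulrnBr ?(ltnW lj) // e addrK.
  pose c' := [fun z => c z with x |-> i].
  have c'N : (\sum_(i in A) c' i = i + N)%N.
    rewrite (big_setD1 _ xA) /= eqxx; congr (_ + _)%N.
    by apply: eq_bigr => z /setD1P[/negPf zx _]; rewrite zx.
  exists g, c'; rewrite c'N; split.
  - move=> z zA /=; case: (eqVneq z x) => [->|zx]; first by case/andP: iN.
    by apply: fc; rewrite !inE zx.
  (* As [i <= N], the intervals [[0, N]] and [[i, i + N]] cover [[0, i + N]]. *)
  - move=> j jN; have [jle|jgt] := leqP j N; first by apply: gN; lia.
    rewrite -(subnKC (ltac:(lia) : (i <= j)%N)) mulrnDr -fxi.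
    apply: (zero_free_sumsetD1 _ _ _ fA xA); apply/sN; exists (j - i)%N => //; lia.
  - move=> a; rewrite sA inE; split.
      case/orP=> [/sN[j jN ->] | /imsetP[_ /sN[j jN ->] ->]]; first by exists j => //; lia.
      by exists (i + j)%N; [lia | rewrite mulrnDr -fxi].
    case=> j jN ->; apply/orP; have [jle|jgt] := leqP j N; first by left; apply/sN; exists j.
    right; apply/imsetP; exists (g *+ (j - i)); first by apply/sN; exists (j - i)%N => //; lia.
    by rewrite fxi -mulrnDr subnKC //; lia.
have feq x : x \in A -> f x = f y.
  move=> xA; apply: (sumset_unit_gain f A fA) => // z zA.
  by have := gain z; rewrite zA /= -leqNgt.
have sumf (B : {set I}) : B \subset A -> \sum_(i in B) f i = f y *+ #|B|.
  by move=> BA; rewrite -sumr_const; apply: eq_bigr => i /(subsetP BA)/feq.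
exists (f y), (fun=> 1%N); rewrite sum1_card; split=> [i /feq -> // | j jA | a].
- have [|B BA Bj] := exists_subset_card A j; first by case/andP: jA.
  rewrite -Bj -sumf //; apply: fA => //; rewrite -card_gt0 Bj; by case/andP: jA.
- split=> [/sumsetP[B BA ->] | [j /exists_subset_card[B BA <-] ->]].
    by exists #|B|; rewrite ?subset_leq_card ?sumf.
  by apply/sumsetP; exists B; rewrite ?sumf.
Qed.

(** * The case k > n: residues modulo K n *)

Lemma sum_inZp {I : finType} (p : nat) (x : I -> nat) (B : {set I}) :
  \sum_(i in B) (inZp (x i) : 'I_p.+1) = inZp (\sum_(i in B) x i)%N.
Proof.
apply/esym/(big_morph (fun m => inZp m : 'I_p.+1)) => [a b|]; apply: val_inj => /=.
  by rewrite modnDm.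
by rewrite mod0n.
Qed.

Lemma inZp_eq0 (p m : nat) : ((inZp m : 'I_p.+1) == 0) = (p.+1 %| m)%N.
Proof. by rewrite -val_eqE. Qed.

Lemma sum_mod_mul {I : finType} (d g : nat) (x c : I -> nat) (B : {set I}) :
  (forall i, x i = c i * g %[mod d]) ->
  (\sum_(i in B) x i = (\sum_(i in B) c i) * g %[mod d])%N.
Proof.
move=> xc; rewrite big_distrl /=.
apply: (big_ind2 (fun a b => a = b %[mod d])) => // a b a' b' e e'.
by rewrite -modnDm e e' modnDm.
Qed.

(** Termwise [2 <= c i + (c i == 1)]; a small sum thus forces many coefficients equal to 1. *)
Lemma card_set_one {I : finType} (c : I -> nat) :
  (forall i, 0 < c i)%N -> (#|I|.*2 <= \sum_i c i + #|[set i | c i == 1%N]|)%N.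
Proof.
move=> c0.
have -> : #|[set i | c i == 1%N]| = (\sum_i (c i == 1%N))%N.
  by rewrite -sum1dep_card big_mkcond; apply: eq_bigr => i _; case: eqP.
rewrite -big_split -muln2 -sum_nat_const; apply: leq_sum => i _ /=.
by have := c0 i; case: (c i) => [|[|k]].
Qed.

Lemma sum_lt_of_no_large_multiple {I : finType} (x : I -> nat) (n K : nat) :
  (0 < n)%N -> (1 < K)%N -> (forall i, 0 < x i)%N ->
  ((K + 1) * n %/ 2 <= #|I|)%N ->
  (forall B : {set I}, n %| \sum_(i in B) x i -> \sum_(i in B) x i < K * n)%N ->
  (\sum_i x i < K * n)%N.
Proof.
move=> n0 K1 x0 cI free.
(* For [n = 1] the length bound only gives [2 #|I| >= K n], one short of what [savchev_chen] needs,
   but [free] applies to the whole set. *)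
have [n1 | n1] := leqP n 1%N.
  have e : n = 1%N by lia.
  have := free setT; rewrite e dvd1n => /(_ isT).
  by under eq_bigl do rewrite inE.
have l2 : ((K + 1) * n <= #|I|.*2.+1)%N.
  by have := divn_eq ((K + 1) * n) 2; have := ltn_pmod ((K + 1) * n) (isT : 0 < 2)%N; lia.
have [p pE] : exists p, (K * n = p.+1)%N by exists (K * n).-1; nia.
pose f i : 'I_p.+1 := inZp (x i).
have f_free : zero_free f setT.
  move=> B _ B0; rewrite sum_inZp inZp_eq0 -pE; apply/negP => KnB.
  have := free B (dvdn_trans (dvdn_mull _ (dvdnn n)) KnB).
  apply/negP; rewrite -leqNgt dvdn_leq //.
  have [i iB] := set0Pn _ B0; rewrite (big_setD1 _ iB) /=.
  by have := x0 i; lia.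
have [|g [c [fc gN cN _]]] := savchev_chen f setT f_free.
  apply: leq_ltn_trans (max_card _) _; rewrite card_ord cardsT -pE; nia.
have c0 i : (0 < c i)%N by case: (fc i).
have NE : (\sum_(i in setT) c i = \sum_i c i)%N by apply: eq_bigl => i; rewrite inE.
rewrite NE cardsT in gN cN.
set N := (\sum_i c i)%N in gN cN NE.
have xc i : x i = c i * g %[mod K * n].
  by rewrite pE mulnC; have [_] := fc i (in_setT i); rewrite Zp_mulrn => /(congr1 val).
have NK : (N < K * n)%N.
  rewrite ltnNge; apply/negP => KN; have := gN (K * n)%N; rewrite KN andbT.
  rewrite Zp_mulrn inZp_eq0 pE dvdn_mull //; apply/implyP; lia.
have lN : (#|I| <= N)%N by rewrite -cardsT -NE leq_card_sum.
have g0 : (0 < g)%N.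
  have := gN 1%N; rewrite mulr1n -val_eqE /=; move: cN lN; case: (val g) => //; lia.
pose U := [set i | c i == 1%N].
(* [2 #|I| >= (K + 1) n - 1] and [N <= K n - 1] differ by at least [n]. *)
have nU : (n <= #|U|)%N by have := card_set_one c c0; rewrite -/U -/N; lia.
(* Modulo [n] the sum of the [x i] is [g] times that of the [c i], so divisibility may be tested on
   the coefficients. *)
have free_c (B : {set I}) : (n %| \sum_(i in B) c i -> \sum_(i in B) x i < K * n)%N.
  move=> nB; apply: free.
  have /(congr1 (modn^~ n)) := sum_mod_mul _ _ _ _ B xc.
  rewrite !modn_dvdm ?dvdn_mull // => e.
  by rewrite /dvdn e -/(dvdn _ _) dvdn_mulr.
have sumU (B : {set I}) : B \subset U -> (\sum_(i in B) c i = #|B|)%N.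
  move=> BU; rewrite -sum1_card; apply: eq_bigr => i /(subsetP BU).
  by rewrite inE => /eqP.
(* At most [n - 1] elements of [U] other than [i] complete [c i] to a multiple of [n]. *)
have xK i : (x i < K * n)%N.
  have cU : (#|U| <= #|U :\ i|.+1)%N by rewrite (cardsD1 i U); case: (i \in U); lia.
  have [|B BU Br] := exists_subset_card (U :\ i) ((n - c i %% n) %% n)%N.
    by have := ltn_pmod (n - c i %% n) n0; lia.
  have iB : i \notin B by apply/negP => /(subsetP BU); rewrite !inE eqxx.
  have := free_c (i |: B); rewrite !big_setU1 //= sumU; last first.
    exact: subset_trans BU (subsetDl _ _).
  rewrite Br /dvdn modnDmr -modnDml subnKC ?modnn //; last by rewrite ltnW ?ltn_pmod.
  by move/(_ isT); lia.
have xE i : (c i * g < K * n)%N -> x i = (c i * g)%N.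
  by move=> cK; have := xc i; rewrite !modn_small.
(* Take [n] elements of [U]: each has [x i >= g], so [n g < K n]. *)
have gK : (g < K)%N.
  have [B BU Bn] := exists_subset_card U n nU.
  have := free_c B; rewrite sumU // Bn dvdnn => /(_ isT).
  have : (\sum_(i in B) g <= \sum_(i in B) x i)%N.
    apply: leq_sum => i /(subsetP BU); rewrite inE => /eqP c1.
    have := xc i; rewrite c1 mul1n pE [RHS]modn_small ?ltn_ord // => <-.
    exact: leq_mod.
  rewrite sum_nat_const Bn; nia.
pose E := [set i | (c i * g < K * n)%N].
have UE : U \subset E by apply/subsetP => i; rewrite !inE => /eqP ->; nia.
have lE : (#|E| + #|~: E| = #|I|)%N by rewrite cardsC.
have splitN : (\sum_(i in E) c i + \sum_(i in ~: E) c i = N)%N.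
  by rewrite -NE [in RHS](big_setID E) /= setTI setTD.
set C := (\sum_(i in E) c i)%N in splitN.
have c2 : (#|~: E| * 2 <= \sum_(i in ~: E) c i)%N.
  rewrite -sum_nat_const; apply: leq_sum => i; rewrite !inE -leqNgt.
  have := c0 i; nia.
have nC : (n <= C)%N.
  apply: leq_trans nU _; rewrite -(sumU U) // /C [X in (_ <= X)%N](big_setID U) /=.
  by rewrite (setIidPr UE) leq_addr.
have CE : (#|E| <= C)%N by apply: leq_card_sum.
have Cdiv := divn_eq C n; have Cmod := ltn_pmod C n0.
set a := (C %/ n)%N in Cdiv.
(* Coefficients outside [E] are at least 2, so [N <= 2 #|I| - 2] passes to [C <= 2 #|E| - 2]. Hence
   [a n] is a sum of coefficients in [E], where [x i = c i g] exactly. *)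
have agK : (a * g < K)%N.
  have [//||| A AE Aa] := subset_sum_interval c E _ _ (a * n)%N.
  - rewrite -/C; lia.
  - rewrite -/C; lia.
  have := free_c A; rewrite Aa dvdn_mull // => /(_ isT).
  have -> : (\sum_(i in A) x i = a * n * g)%N.
    rewrite -Aa big_distrl; apply: eq_bigr => i /(subsetP AE); rewrite inE; exact: xE.
  nia.
have [q0 | q0] := posnP #|~: E|.
  have ET i : i \in E.
    by apply/negPn; rewrite -in_setC; move/eqP: q0; rewrite cards_eq0 => /eqP ->; rewrite inE.
  (* If [g >= 2], then [2 a <= K - 1], so [2 N <= 2 a n + 2 n - 2 <= (K + 1) n - 2 < 2 #|I|],
     against [#|I| <= N]. *)
  have g1 : g = 1%N :> nat by nia.
  rewrite (eq_bigr c) // => i _; rewrite xE ?g1 ?muln1 //.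
  by have := ET i; rewrite inE g1 muln1.
(* Outside [E], [c i g >= K n > a g n], so [c i > a n]. *)
have cbig : (#|~: E| * (a * n).+1 <= \sum_(i in ~: E) c i)%N.
  rewrite -sum_nat_const; apply: leq_sum => i; rewrite !inE -leqNgt; nia.
have a0 : (0 < a)%N by nia.
(* With [q = #|~: E|], the bounds [(K + 1) n - 1 <= 2 #|I| <= 2 (C + q)],
   [C + q (a n + 1) <= N <= K n - 1] and [C <= a n + n - 1] give [(q - 1) (a n - 1) <= 0], while
   [a n >= 2]. *)
have q1 : #|~: E| = 1%N by nia.
rewrite q1 mul1n in cbig.
(* For [q = 1] all these bounds are equalities; then [n] divides 1. *)
have eK : (K * n = a * n + a * n + n + 1)%N by lia.
have : (n %| a * n + a * n + n + 1)%N by rewrite -eK dvdn_mull.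
by rewrite dvdn_addr ?dvdn1 ?dvdn_add ?dvdn_mull // => /eqP; lia.
Qed.

(** * Multiples of the generator and idempotent sums *)

Lemma smulD {S : addSemigroupType} (s : S) (t u : nat) :
  (0 < t)%N -> (0 < u)%N -> smul s (t + u) = smul s t + smul s u.
Proof.
rewrite /smul; case: t u => [|t] [|u] // _ _.
rewrite addSn addnS /=; elim: t => //= t IH; by rewrite IH Algebra.addrA.
Qed.

Lemma smul_eqP {S : addSemigroupType} {s : S} {k n : nat}
    (C : cyclic_semigroup s k n) (i d : nat) :
  (0 < i)%N -> (0 < d)%N ->
  smul s i = smul s (i + d) <-> (k <= i)%N /\ (n %| d)%N.
Proof.
move=> i0 d0.
have [[k0 _] k_min] := cyclic_index C; have [[n0 period] n_min] := cyclic_period C.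
have period_from j : (k <= j)%N -> smul s (j + n) = smul s j.
  move=> kj; have [jk|jk] := posnP (j - k)%N.
    by have -> : j = k by lia.
  rewrite -[in RHS](subnKC kj) [in RHS]smulD // -period -smulD ?addn_gt0 ?k0 //.
  by congr smul; lia.
have shift j m : (k <= j)%N -> smul s (j + n * m) = smul s j.
  move=> kj; elim: m => [|m IH]; first by rewrite muln0 addn0.
  by rewrite -[in RHS]IH -[in RHS]period_from ?(leq_trans kj) ?leq_addr // mulnS; congr smul; lia.
split=> [e|[ki /dvdnP[m ->]]]; last by rewrite mulnC shift.
have ki : (k <= i)%N by apply: k_min; split=> //; exists (i + d)%N; split=> //; lia.
split=> //.
have ni : (i <= n * i)%N by rewrite leq_pmull.
have : smul s (i + (n * i + k - i)) = smul s (i + d + (n * i + k - i)).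
  by rewrite !(smulD s _ (n * i + k - i)) ?addn_gt0 ?i0 -?e //; lia.
have -> : (i + (n * i + k - i) = k + n * i)%N by lia.
have -> : (i + d + (n * i + k - i) = k + d %% n + n * (i + d %/ n))%N.
  by rewrite mulnDr [X in (_ = _ + (_ + X))%N]mulnC; have := divn_eq d n; lia.
rewrite !shift ?leq_addr // => /esym ek; rewrite /dvdn -leqn0 leqNgt.
apply/negP => r0; have := n_min _ (conj r0 ek).
by rewrite leqNgt ltn_pmod.
Qed.

Lemma ind_gt0 {S : addSemigroupType} {s : S} {k n : nat}
  (C : cyclic_semigroup s k n) a : (0 < ind C a)%N.
Proof. by rewrite /ind; case: ex_minnP => t /andP[]. Qed.

Lemma smul_ind {S : addSemigroupType} {s : S} {k n : nat}
  (C : cyclic_semigroup s k n) a : smul s (ind C a) = a.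
Proof. by rewrite /ind; case: ex_minnP => t /andP[_ /eqP]. Qed.

(** This is [smul_eqP] with [i] and [d] both equal to the index sum; the empty [U] is harmless
    because [0 < k]. *)
Lemma idempotent_sum_freeP {S : addSemigroupType} {s : S} {k n : nat}
    (C : cyclic_semigroup s k n) (T : seq S) :
  idempotent_sum_free T <->
  forall U, subseq U T -> (n %| \sum_(a <- U) ind C a)%N ->
    (\sum_(a <- U) ind C a < k)%N.
Proof.
have [[k0 _] _] := cyclic_index C.
have foldl_smul t U : (0 < t)%N ->
    foldl +%R (smul s t) U = smul s (t + \sum_(a <- U) ind C a)%N.
  elim: U t => [|u U IH] t t0 /=; first by rewrite big_nil addn0.
  rewrite big_cons addnA -{1}(smul_ind C u) -smulD ?ind_gt0 // IH //.
  by rewrite addn_gt0 t0.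
have foldlE x U : foldl +%R x U = smul s (\sum_(a <- x :: U) ind C a)%N.
  by rewrite big_cons -foldl_smul ?ind_gt0 ?smul_ind.
have sum_gt0 x U : (0 < \sum_(a <- x :: U) ind C a)%N.
  by rewrite big_cons addn_gt0 ind_gt0.
split=> [free [|x U] UT nU | free e [x [U [UT ->]]]]; first by rewrite big_nil.
  rewrite ltnNge; apply/negP => kU; apply: (free (foldl +%R x U)).
    by exists x, U.
  rewrite foldlE -smulD ?sum_gt0 //; apply/esym.
  by apply/(smul_eqP C); rewrite ?sum_gt0.
rewrite foldlE -smulD ?sum_gt0 // => /esym/(smul_eqP C)[]; rewrite ?sum_gt0 // => kU nU.
by have := free _ UT nU; rewrite ltnNge kU.
Qed.

(** * Subsequences as index sets, and a criterion for smoothness *)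

Lemma subsums_mapP {V : eqType} {G : zmodType} (F : V -> G) (r : seq V) (a : G) :
  subsums [seq F v | v <- r] a <->
  exists U, [/\ subseq U r, U != [::] & a = \sum_(v <- U) F v].
Proof.
have foldlE (x : G) W : foldl +%R x W = \sum_(b <- x :: W) b.
  elim: W x => [|w W IH] x /=; first by rewrite big_seq1.
  by rewrite IH !big_cons addrA.
split=> [[x [W [/subseqP[m _ xW] ->]]] | [U [Ur U0 ->]]].
  exists (mask m r); rewrite mask_subseq; split=> //.
    by move: xW; rewrite -map_mask; case: (mask m r).
  by rewrite foldlE xW -map_mask big_map.
case: U U0 Ur => // u U _ Ur; exists (F u), (map F U); split.
  exact: (map_subseq F Ur).
by rewrite foldlE -map_cons big_map.
Qed.

(** One [B] serves every [F], so the size of [U] and its sums under different maps are read off from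
    the same set. *)
Lemma subseq_index_set {V : eqType} {r U : seq V} : subseq U r ->
  exists B : {set 'I_(size r)}, forall (M : nmodType) (F : V -> M),
    \sum_(v <- U) F v = \sum_(i in B) F (tnth (in_tuple r) i).
Proof.
case/subseqP=> m _ ->; exists [set i : 'I_(size r) | nth false m i] => M F.
by rewrite big_mask; apply: eq_bigl => i; rewrite inE andbT.
Qed.

Lemma index_set_subseq {V : eqType} (r : seq V) (B : {set 'I_(size r)}) :
  exists2 U, subseq U r & forall (M : nmodType) (F : V -> M),
    \sum_(v <- U) F v = \sum_(i in B) F (tnth (in_tuple r) i).
Proof.
exists (mask [seq i \in B | i <- enum 'I_(size r)] r); first exact: mask_subseq.
move=> M F; rewrite big_mask; apply: eq_bigl => i.
by rewrite andbT (nth_map i) ?size_enum_ord ?ltn_ord // nth_ord_enum.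
Qed.

(** The bound on the sum works twice: it forces a coefficient 1 by [card_set_one], and it makes
    every value up to the total a subset sum by [subset_sum_interval]. *)
Lemma smooth_of_small_sum {V : eqType} {G : zmodType} (F : V -> G) (r : seq V)
    (g : G) (c : 'I_(size r) -> nat) :
  (forall i, 0 < c i)%N -> (\sum_i c i < (size r).*2)%N ->
  (forall i, F (tnth (in_tuple r) i) = g *+ c i) ->
  lt_add_order (\sum_i c i)%N g ->
  smooth g [seq F v | v <- r].
Proof.
move=> c0 cr Fc gN.
pose ns := sort leq [seq c i | i <- enum 'I_(size r)].
have sum_ns : sumn ns = (\sum_i c i)%N.
  by rewrite (perm_sumn (permEl (perm_sort _ _))) sumnE big_map big_enum.
have sorted_ns : sorted leq ns by apply: sort_sorted; exact: leq_total.
exists ns; split=> //.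
- rewrite perm_sym (perm_trans (perm_map _ (permEl (perm_sort _ _)))) //.
  rewrite -map_comp (eq_map (g := fun i => F (tnth (in_tuple r) i))) //.
  by rewrite map_comp map_tnth_enum.
- split=> //.
  have [i /[!inE]/eqP ci] : exists i, i \in [set i | c i == 1%N].
    by apply/set0Pn; rewrite -card_gt0; have := card_set_one c c0; rewrite card_ord; lia.
  have ns1 : 1%N \in ns by rewrite mem_sort -ci map_f // mem_enum.
  have ns0 m : m \in ns -> (0 < m)%N by rewrite mem_sort => /mapP[j _ ->].
  case: ns sorted_ns ns1 ns0 {sum_ns} => // m ms /= ms_sorted ns1 ns0.
  congr Some; apply/eqP; rewrite eqn_leq ns0 ?mem_head // andbT.
  move: ns1; rewrite inE => /orP[/eqP <- // | ].
  by have /allP := order_path_min leq_trans ms_sorted; apply.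
- by rewrite sum_ns.
- move=> a; rewrite sum_ns; split.
    case/subsums_mapP=> U [Ur U0 ->]; have [B sumB] := subseq_index_set Ur.
    exists (\sum_(i in B) c i)%N; last first.
      by rewrite sumB -sumrMnr; apply: eq_bigr => i _; exact: Fc.
    have B0 : B != set0.
      apply: contraNneq U0 => B0; have /= := sumB nat (fun=> 1%N).
      by rewrite B0 big_set0 -size_eq0 -sum1_size => ->.
    have [i iB] := set0Pn _ B0.
    have -> : (\sum_(i in B) c i <= \sum_i c i)%N by rewrite [leqRHS](bigID (mem B)) leq_addr.
    by rewrite andbT (big_setD1 _ iB) /=; have := c0 i; lia.
  case=> j jN ->; have [//||| B _ Bj] := subset_sum_interval c setT _ _ j.
  - rewrite cardsT card_ord (eq_bigl xpredT) => [|i]; [lia | by rewrite inE].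
  - by rewrite (eq_bigl xpredT) => [|i]; [lia | rewrite inE].
  have [U Ur sumU] := index_set_subseq r B.
  apply/subsums_mapP; exists U; split=> //.
    apply: contraTneq jN => U0; have /= := sumU nat (fun=> 1%N).
    rewrite U0 big_nil => /esym/eqP; rewrite sum_nat_const muln1 cards_eq0 => /eqP B0.
    by rewrite -Bj B0 big_set0.
  by rewrite sumU -Bj -sumrMnr; apply: eq_bigr => i _; rewrite Fc.
Qed.

(** * The case k <= n: residues modulo n *)

Lemma mulrn_Zmod_eq0 (n : nat) (g : Zmod n) (j : nat) :
  (0 < n)%N -> (g *+ j == 0) = (n %| (g : 'I_n.-1.+1) * j)%N.
Proof. by case: n g => // n g _; rewrite Zp_mulrn; exact: inZp_eq0. Qed.

(** The multiple [n / gcd(g, n)] kills [g], so it exceeds [N]; with [n < 2 (N + 1)] this makes the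
    gcd 1. *)
Lemma add_order_Zmod (n : nat) (g : Zmod n) (N : nat) :
  (0 < n)%N -> (n < N.+1.*2)%N ->
  (forall j, (0 < j <= N)%N -> g *+ j != 0) -> add_order g n.
Proof.
move=> n0 nN gN; pose v : nat := (g : 'I_n.-1.+1).
have gE j : (g *+ j == 0) = (n %| v * j)%N by exact: mulrn_Zmod_eq0.
split=> [|j [j0 /eqP]]; first by split=> //; apply/eqP; rewrite gE dvdn_mull.
have d0 : (0 < gcdn v n)%N by rewrite gcdn_gt0 n0 orbT.
have dn := divnK (dvdn_gcdr v n).
have No : (N < n %/ gcdn v n)%N.
  rewrite ltnNge; apply/negP => oN; have := gN (n %/ gcdn v n)%N.
  rewrite oN andbT gE divn_gt0 // dvdn_leq ?dvdn_gcdr // => /(_ isT)/negP; apply.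
  by rewrite muln_divCA_gcd dvdn_mulr.
have co : coprime n v.
  by rewrite coprime_sym /coprime; nia.
by rewrite gE Gauss_dvdr // => /dvdn_leq; apply.
Qed.

Lemma sumr_Zmod {V : Type} (n : nat) (F : V -> nat) (r : seq V) :
  \sum_(v <- r) to_Zmod n (F v) = to_Zmod n (\sum_(v <- r) F v).
Proof.
apply/esym/(big_morph (to_Zmod n)) => [a b|]; apply: val_inj => /=.
  by rewrite modnDm.
by rewrite mod0n.
Qed.

(** A nonempty [U] with sum divisible by [n] would give [j g = 0] with [0 < j < n = ord(g)]; only
    the empty [U] remains. *)
Lemma sum_free_of_smooth {V : eqType} (n k : nat) (F : V -> nat) (T : seq V)
    (g : Zmod n) : (0 < k)%N -> (0 < n)%N ->
  add_order g n -> smooth g [seq to_Zmod n (F a) | a <- T] ->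
  forall U, subseq U T -> (n %| \sum_(a <- U) F a)%N -> (\sum_(a <- U) F a < k)%N.
Proof.
move=> k0 n0 ord_g [ns [_ _ /(_ n ord_g) ns_n sums]] U UT nU.
have [->|U0] := eqVneq U [::]; first by rewrite big_nil.
have /sums[j jN /esym gj] : subsums [seq to_Zmod n (F a) | a <- T] 0.
  apply/subsums_mapP; exists U; split=> //.
  by rewrite sumr_Zmod; apply/esym/eqP; case: (n) n0 nU => // m _; rewrite inZp_eq0.
case: ord_g => _ /(_ j) ord_j.
by have := ord_j (conj (proj1 (andP jN)) gj); lia.
Qed.

Lemma smooth_of_sum_free {V : eqType} (n k : nat) (F : V -> nat) (T : seq V) :
  (0 < n)%N -> (k <= n)%N -> (n < (size T).*2)%N -> (forall a, 0 < F a)%N ->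
  (forall U, subseq U T -> (n %| \sum_(a <- U) F a)%N -> (\sum_(a <- U) F a < k)%N) ->
  exists g : Zmod n, add_order g n /\ smooth g [seq to_Zmod n (F a) | a <- T].
Proof.
move=> n0 kn nT F0 free.
pose f i : 'I_n.-1.+1 := inZp (F (tnth (in_tuple T) i)).
(* A nonempty sum divisible by [n] is at least [n >= k]. *)
have f_free : zero_free f setT.
  move=> B _ B0; rewrite sum_inZp inZp_eq0 prednK //.
  have [U UT sumU] := index_set_subseq T B.
  have sumF := sumU nat F; rewrite -[X in (_ %| X)%N]sumF.
  apply/negP => nU; have Uk := free U UT nU.
  have [i iB] := set0Pn _ B0.
  have : (0 < \sum_(a <- U) F a)%N.
    by rewrite [X in (_ < X)%N]sumF (big_setD1 _ iB) /= addn_gt0 F0.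
  by move/dvdn_leq => /(_ _ nU); lia.
have [|g [c [fc gN cN _]]] := savchev_chen f setT f_free.
  by apply: leq_ltn_trans (max_card _) _; rewrite card_ord cardsT card_ord prednK.
have NE : (\sum_(i in setT) c i = \sum_i c i)%N by apply: eq_bigl => i; rewrite inE.
have Nge : (size T <= \sum_i c i)%N.
  by rewrite -NE -[X in (X <= _)%N]card_ord -cardsT leq_card_sum // => i; case: (fc i).
rewrite NE cardsT card_ord in gN cN.
exists g; split; first by apply: (@add_order_Zmod n g (\sum_i c i)%N) => //; lia.
apply: (smooth_of_small_sum _ T g c) => [i||i|m [[m0 gm] _]].
- by case: (fc i).
- lia.
- by case: (fc i).
- by rewrite ltnNge; apply/negP => mN; have := gN m; rewrite m0 mN gm eqxx => /(_ isT).
Qed.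

(** * The case k > n for sequences, and the equivalence *)

Lemma sum_lt_of_sum_free {V : eqType} (n K : nat) (F : V -> nat) (T : seq V) :
  (0 < n)%N -> (1 < K)%N -> ((K + 1) * n %/ 2 <= size T)%N -> (forall a, 0 < F a)%N ->
  (forall U, subseq U T -> (n %| \sum_(a <- U) F a)%N ->
     (\sum_(a <- U) F a < K * n)%N) ->
  (\sum_(a <- T) F a < K * n)%N.
Proof.
move=> n0 K1 cT F0 free; rewrite big_tnth.
apply: sum_lt_of_no_large_multiple => //; first by rewrite card_ord.
move=> B; have [U UT sumU] := index_set_subseq T B.
have sumF := sumU nat F; rewrite -[X in (_ %| X)%N]sumF -[X in (X < _)%N]sumF.
exact: free.
Qed.

Lemma smooth_int {V : eqType} (F : V -> nat) (T : seq V) :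
  (forall a, 0 < F a)%N -> (\sum_(a <- T) F a < (size T).*2)%N ->
  smooth (1 : int) [seq (F a)%:Z | a <- T].
Proof.
move=> F0 sT.
apply: (smooth_of_small_sum _ T 1 (fun i => F (tnth (in_tuple T) i))) => [//||i|m [[m0 gm] _]].
- by move: sT; rewrite big_tnth.
- by rewrite natz.
(* No positive multiple of 1 vanishes in Z, so the order condition is vacuous. *)
- by move: gm m0; rewrite natz => -[->].
Qed.

Theorem theorem3p10 (k n : nat) (hk : (1 <= k)%N) (hn : (1 <= n)%N)
    (S : addSemigroupType) (s : S) (C : cyclic_semigroup s k n) (T : seq S)
    (hT : ((if (n < k)%N then ((ceil_div k n + 1) * n) %/ 2
            else n %/ 2 + 1) <= size T)%N) :
  idempotent_sum_free T <->
    [/\ (n < k)%N,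
        smooth (1 : int) [seq (ind C a)%:Z | a <- T]
      & (\sum_(a <- T) ind C a <= ceil_div k n * n - 1)%N]
    \/
    ((k <= n)%N /\
     exists g : Zmod n,
       add_order g n /\ smooth g [seq to_Zmod n (ind C a) | a <- T]).
Proof.
rewrite (idempotent_sum_freeP C).
(* Division with remainder of [k + n - 1] by [n] yields [k <= K n < k + n]. *)
set K := ceil_div k n; have Kdiv := divn_eq (k + n - 1) n.
have Kmod := ltn_pmod (k + n - 1) hn; rewrite -/(ceil_div k n) -/K in Kdiv.
have [nk | kn] := ltnP n k; last first.
  rewrite ltnNge kn /= in hT.
  split=> [free | [[] // | [_ [g [ord_g sm]]]]]; last exact: sum_free_of_smooth sm.
  right; split=> //; apply: smooth_of_sum_free free => //; last exact: ind_gt0.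
  by apply: (@leq_trans (n %/ 2 + 1).*2); [lia | rewrite leq_double].
rewrite nk in hT.
have K1 : (1 < K)%N by nia.
split=> [free | [[_ _ sumT] U UT /dvdnP[m mU] | [] //]].
  left; have sumT : (\sum_(a <- T) ind C a < K * n)%N.
    apply: sum_lt_of_sum_free => //; first exact: ind_gt0.
    by move=> U UT nU; have := free U UT nU; lia.
  split=> //; last lia.
  apply: smooth_int; first exact: ind_gt0.
  (* Doubling the floor loses at most 1: [(K + 1) n - 1 >= K n]. *)
  apply: (leq_trans sumT); apply: (@leq_trans ((K + 1) * n %/ 2).*2); last by rewrite leq_double.
  by rewrite mulnDl mul1n; lia.
have sumU : (\sum_(a <- U) ind C a <= \sum_(a <- T) ind C a)%N.
  have [B sumB] := subseq_index_set UT; have sumB' := sumB nat (ind C).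
  rewrite [leqLHS]sumB' big_tnth [leqRHS](bigID (mem B)); exact: leq_addr.
(* A multiple of [n] below [K n] is at most [(K - 1) n < k]. *)
have mK : (m < K)%N by nia.
rewrite mU; nia.
Qed.
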